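(* Let $E\subseteq\mathbb R^{+}$ be strongly porous on the right at $0$ and let $0\in ac\,E$. The following conditions are equivalent. (i) $E$ is completely strongly porous (a CSP-set). (ii) The preordered set $(\tilde I_E^{d},\preceq)$ contains a universal element $\tilde L=\{(l_n,m_n)\}_{n\in\mathbb N}\in\tilde I_E^{sd}$ with $M(\tilde L)<\infty$. (iii) $E$ is uniformly strongly porous.
   Context: $\mathbb R^{+}=[0,\infty)$ with the standard topology. For $E\subseteq\mathbb R^{+}$, $Ext\,E$ is the exterior of $E$ and $ac\,E$ the set of accumulation points of $E$ (both relative to $\mathbb R^{+}$). The right porosity of $E$ at $0$ is $p^{+}(E,0)=\limsup_{h\to0^{+}}\lambda(E,0,h)/h$, where $\lambda(E,0,h)$ is the length of the largest open subinterval of $(0,h)$ containing no point of $E$; $E$ is strongly porous on the right at $0$ if $p^{+}(E,0)=1$. A real sequence $\{\tau_n\}$ is almost decreasing (almost strictly decreasing) if $\tau_{n+1}\le\tau_n$ (respectively $\tau_{n+1}<\tau_n$) for all sufficiently large $n$. $\tilde E_0^{d}$ is the set of almost decreasing sequences $\tilde\tau=\{\tau_n\}_{n\in\mathbb N}$ with $\tau_n\in E\setminus\{0\}$ for all $n$ and $\lim_n\tau_n=0$. $\tilde I_E$ is the set of sequences $\{(a_n,b_n)\}_{n\in\mathbb N}$ of open intervals $(a_n,b_n)\subseteq\mathbb R^{+}$ such that every $a_n>0$; every $(a_n,b_n)$ is a connected component of $Ext\,E$ (that is, $(a_n,b_n)\cap E=\varnothing$, and every open interval $(a,b)\supseteq(a_n,b_n)$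 with $(a,b)\ne(a_n,b_n)$ meets $E$); $\lim_n a_n=0$; and $\lim_n (b_n-a_n)/b_n=1$. $\tilde I_E^{d}$ (respectively $\tilde I_E^{sd}$) is the set of those $\{(a_n,b_n)\}\in\tilde I_E$ for which $\{a_n\}$ is almost decreasing (respectively almost strictly decreasing). For sequences of strictly positive numbers, $\{a_n\}\asymp\{\gamma_n\}$ means that there are constants $c_1,c_2>0$ with $c_1a_n\le\gamma_n\le c_2a_n$ for all sufficiently large $n$. For $\tilde\gamma\in\tilde E_0^{d}$, $E$ is $\tilde\gamma$-strongly porous if there is $\{(a_n,b_n)\}\in\tilde I_E$ with $\tilde\gamma\asymp\{a_n\}$. $E$ is completely strongly porous (a CSP-set) if it is $\tilde\gamma$-strongly porous for every $\tilde\gamma\in\tilde E_0^{d}$. $E$ is uniformly strongly porous if there is a constant $c>0$ such that for every $\tilde\tau\in\tilde E_0^{d}$ there is $\{(a_n,b_n)\}\in\tilde I_E$ with $a_n\ge\tau_n$ for all sufficiently large $n$ and $\limsup_n a_n/\tau_n\le c$. For $\tilde A=\{(a_n,b_n)\}$ and $\tilde L=\{(l_n,m_n)\}$ in $\tilde I_E^{d}$, write $\tilde A\preceq\tilde L$ if there are $N_1\in\mathbb N$ and a function $f:\{N_1,N_1+1,\dots\}\to\mathbb N$ with $a_n=l_{f(n)}$ for all $n\ge N_1$. An element $\tilde L\in\tilde I_E^{d}$ is universal if $\tilde A\preceq\tilde L$ for every $\tilde A\in\tilde I_E^{d}$. For universal $\tilde L=\{(l_n,m_n)\}$, $M(\tilde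 L)=\limsup_{n\to\infty} l_n/m_{n+1}$. *)

(* Defs.v *)
From HB Require Import structures.
From mathcomp Require Import all_boot all_order all_algebra.
From mathcomp Require Import all_classical all_reals all_analysis.
From mathcomp Require Import lra.

Set Implicit Arguments.
Unset Strict Implicit.
Unset Printing Implicit Defensive.

Import Order.TTheory GRing.Theory Num.Theory.
Import numFieldNormedType.Exports.

Local Open Scope classical_set_scope.
Local Open Scope ring_scope.

Section Defs.
Context {R : realType}.
Implicit Types (E : set R) (t u : nat -> R) (A L : nat -> R * R).

Definition Rplus : set R := `[0, +oo[.

(* The topological exterior of [E] in the subspace [Rplus]: the neighbourhoods
   are taken relative to [Rplus]. *)
Definition Ext E : set R :=
  [set x | Rplus x /\ \forall y \near within Rplus (nbhs x), ~ E y].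

Definition is_component (A C : set R) : Prop :=
  exists2 x, A x & C = connected_component A x.

(* Degenerate intervals (a = b) are allowed, so the set is never empty for
   0 <= h, and the value is 0 if every nonempty open subinterval meets [E]. *)
Definition gap_length E (h : R) : R :=
  sup [set l | exists a b : R,
    [/\ 0 <= a, a <= b, b <= h, `]a, b[ `&` E = set0 & l = b - a]].

Definition right_porosity E : \bar R :=
  limf_esup (fun h => (gap_length E h / h)%:E) 0^'+.

Definition strongly_porous E : Prop := right_porosity E = 1%:E.

Definition almost_decreasing t : Prop :=
  \forall n \near \oo, t n.+1 <= t n.

Definition almost_strictly_decreasing t : Prop :=
  \forall n \near \oo, t n.+1 < t n.

Definition E0d E : set (nat -> R) :=
  [set t | [/\ almost_decreasing t,
               forall n, E (t n) /\ t n != 0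
             & t @ \oo --> (0 : R)]].

(* A sequence of open intervals is given by its sequence of pairs of
   endpoints. *)
Definition lend A (n : nat) : R := (A n).1.
Definition rend A (n : nat) : R := (A n).2.

Definition IE E : set (nat -> R * R) :=
  [set A | [/\ forall n, 0 < lend A n,
               forall n, is_component (Ext E) `]lend A n, rend A n[,
               lend A @ \oo --> (0 : R)
             & (fun n => (rend A n - lend A n) / rend A n) @ \oo --> (1 : R)]].

Definition IEd E : set (nat -> R * R) :=
  [set A | IE E A /\ almost_decreasing (lend A)].

Definition IEsd E : set (nat -> R * R) :=
  [set A | IE E A /\ almost_strictly_decreasing (lend A)].

Definition asymp t u : Prop :=
  exists c1 c2 : R, [/\ 0 < c1, 0 < c2
    & \forall n \near \oo, c1 * t n <= u n <= c2 * t n].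

Definition seq_strongly_porous E t : Prop :=
  exists2 A, IE E A & asymp t (lend A).

Definition completely_strongly_porous E : Prop :=
  forall t, E0d E t -> seq_strongly_porous E t.

Definition uniformly_strongly_porous E : Prop :=
  exists2 c : R, 0 < c & forall t, E0d E t ->
    exists A, [/\ IE E A,
      \forall n \near \oo, t n <= lend A n
    & (limn_esup (fun n => (lend A n / t n)%:E) <= c%:E)%E].

Definition preceq A L : Prop :=
  exists (N1 : nat) (f : nat -> nat),
    forall n, (N1 <= n)%N -> lend A n = lend L (f n).

Definition universal E L : Prop :=
  IEd E L /\ forall A, IEd E A -> preceq A L.

Definition M L : \bar R := limn_esup (fun n => (lend L n / rend L n.+1)%:E).

Lemma subset_Ext E (a b : R) : 0 <= a -> `]a, b[ `&` E = set0 ->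
  `]a, b[ `<=` Ext E.
Proof.
move=> a0 abE x xab; split.
  by move: xab; rewrite /Rplus /= !in_itv /= andbT; lra.
have : nbhs x `]a, b[%classic by apply: open_nbhs_nbhs; split.
rewrite near_withinE; apply: filterS => y yab _ Ey.
by have : (`]a, b[ `&` E) y by []; rewrite abE.
Qed.

Lemma Ext_ball E (x : R) : 0 < x -> Ext E x ->
  exists2 e : R, 0 < e & `]x - e, x + e[ `&` E = set0.
Proof.
move=> x0 [_]; rewrite near_withinE => /nbhs_ballP[e /= e0 xE].
pose d := Num.min e x.
have [d0 de dx] : [/\ 0 < d, d <= e & d <= x].
  by rewrite /d lt_min e0 x0 ge_min lexx /= ge_min lexx orbT.
exists d => //; rewrite -subset0 => y [] /=; rewrite in_itv /= => xdy Ey.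
apply: (xE y) => //; last by rewrite /Rplus /= in_itv /= andbT; lra.
by rewrite /ball /= ltr_distlC; lra.
Qed.

(* The components of the exterior, in terms of open intervals missing [E]. *)
Lemma component_ExtP E (a b : R) : 0 < a ->
  is_component (Ext E) (`]a, b[) <->
  [/\ a < b, `]a, b[ `&` E = set0
    & forall c d : R, `]a, b[ `<=` `]c, d[ -> (c, d) <> (a, b) ->
        (`]c, d[ `&` E) !=set0].
Proof.
move=> a0; split.
- move=> [x Ax abC].
  have xab : `]a, b[%classic x by rewrite abC; exact: connected_component_refl.
  have ax : a < x < b by move: xab; rewrite /= in_itv.
  split; first by lra.
    rewrite -subset0 => y [yab Ey].
    have [y0 yE] : Ext E y.
      by apply: (@connected_component_sub _ _ x); rewrite -abC.
    by move: yE; rewrite near_withinE => /nbhs_singleton/(_ y0).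
  move=> c d abcd cdab; apply/set0P/eqP => cdE; apply: cdab.
  have xcd : c < x < d by have := abcd x xab; rewrite /= in_itv.
  have sub (y : R) : 0 < y -> c < y < d -> a < y < b.
    move=> y0 ycd; pose c' := Num.max c 0.
    have c'E (z : R) : (c' < z) = (c < z) && (0 < z) by rewrite /c' gt_max.
    suff : `]c', d[%classic y -> `]a, b[%classic y.
      by rewrite /= !in_itv /=; apply; rewrite c'E y0; lra.
    apply: (_ : `]c', d[%classic `<=` `]a, b[%classic).
    rewrite [X in _ `<=` X]abC.
    apply: connected_component_max.
    + by rewrite /= in_itv /= c'E; lra.
    + apply: subset_Ext; first by rewrite /c' le_max lexx orbT.
      rewrite -subset0 => z [] /=; rewrite in_itv /= c'E => zcd Ez.
      suff : (`]c, d[ `&` E) z by rewrite cdE.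
      by split => //=; rewrite in_itv /=; lra.
    + by apply/connected_intervalP; exact: interval_is_interval.
  have ca : a <= c.
    by rewrite leNgt; apply/negP => ca; have := sub a a0; lra.
  have db : d <= b.
    by rewrite leNgt; apply/negP => bd; have := sub b; lra.
  have ac : c <= a.
    rewrite leNgt; apply/negP => ac.
    have : c <= x by lra.
    move=> cx; have := abcd ((a + c) / 2); rewrite /= !in_itv /=; lra.
  have bd : b <= d.
    rewrite leNgt; apply/negP => bd.
    have := abcd ((d + b) / 2); rewrite /= !in_itv /=; lra.
  by congr pair; lra.
- move=> [ab abE abmax]; pose x := (a + b) / 2.
  have xab : `]a, b[%classic x by rewrite /= in_itv /= /x; lra.
  have abExt : `]a, b[ `<=` Ext E by apply: subset_Ext => //; exact: ltW.
  exists x; first exact: abExt.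
  have aN : ~ Ext E a.
    move=> /(Ext_ball a0)[e e0 aE].
    have [||z []] := abmax (a - e) b.
    + by move=> z /=; rewrite !in_itv /=; lra.
    + by move=> [] *; lra.
    rewrite /= in_itv /= => zab Ez.
    case: (ltP z (a + e)) => [za|az].
      suff : (`]a - e, a + e[ `&` E) z by rewrite aE.
      by split => //=; rewrite in_itv /=; lra.
    suff : (`]a, b[ `&` E) z by rewrite abE.
    by split => //=; rewrite in_itv /=; lra.
  have bN : ~ Ext E b.
    move=> /(Ext_ball (lt_trans a0 ab))[e e0 bE].
    have [||z []] := abmax a (b + e).
    + by move=> z /=; rewrite !in_itv /=; lra.
    + by move=> [] *; lra.
    rewrite /= in_itv /= => zab Ez.
    case: (ltP (b - e) z) => [zb|bz].
      suff : (`]b - e, b + e[ `&` E) z by rewrite bE.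
      by split => //=; rewrite in_itv /=; lra.
    suff : (`]a, b[ `&` E) z by rewrite abE.
    by split => //=; rewrite in_itv /=; lra.
  apply/seteqP; split.
    apply: connected_component_max => //.
    by apply/connected_intervalP; exact: interval_is_interval.
  have /connected_intervalP Ci := @component_connected _ (Ext E) x.
  have Cx : connected_component (Ext E) x x.
    by apply: connected_component_refl; exact: abExt.
  have sub : connected_component (Ext E) x `<=` Ext E.
    exact: connected_component_sub.
  move=> y Cy; rewrite /= in_itv /= !ltNge; apply/andP; split; apply/negP => h.
  + by apply/aN/sub/(Ci _ _ Cy Cx); rewrite /x; lra.
  + by apply/bN/sub/(Ci _ _ Cx Cy); rewrite /x; lra.
Qed.

End Defs.

(* Main.v *)
Require Import Defs.
From HB Require Import structures.
From mathcomp Require Import all_boot all_order all_algebra.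
From mathcomp Require Import all_classical all_reals all_analysis.
From mathcomp Require Import lra.
Import Order.TTheory GRing.Theory Num.Theory.
Import numFieldNormedType.Exports.
Local Open Scope classical_set_scope.
Local Open Scope ring_scope.

(** Call a gap (a component of the exterior of [E] with positive left endpoint)
    [(a, b)] [e]-wide when [a <= e * b].

    The crux is that complete strong porosity, a statement about one sequence
    at a time, is equivalent to a statement about points: there is a constant
    [C >= 1] such that, for every [e > 0], each point [t] of [E] close enough
    to 0 has an [e]-wide gap whose left endpoint lies in [[t / C, C * t]]
    ([gaps_comparable]).  If every [C = 1, 2, 3, ...] failed with its own width
    [e_C], one sequence in [E] visiting counterexamples for each [C]
    infinitely often would defeat every sequence of gaps: comparability with
    constants [c1, c2] fails at the counterexamples for any [C] above [1 / c1]
    and [c2] ([csp_gaps_comparable]).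

    Given such a [C], consider the gaps that are [1 / (2 * C)]-wide.  This
    threshold is chosen so that near 0 no other gap can be the one that
    [gaps_comparable] finds at points of [E] next to the left endpoint of such
    a gap; hence these gaps are automatically [e]-wide for each [e], once close
    enough to 0 ([wide_gap_improve]).  Their left endpoints at least halve from
    one gap to the next towards 0, so they can be listed in decreasing order,
    and this list [L] is a universal element: the gaps of any other admissible
    sequence eventually pass the threshold and therefore occur in [L].
    Applying [gaps_comparable] at a point of [E] just to the right of the gap
    [L n.+1] gives [M L <= 2 * C] ([universal_of_comparable]).

    Conversely, if [M L] is finite, a small point [t] of [E] falls between
    consecutive gaps of [L], say [m_{k+1} <= t <= l_k], and
    [l_k <= K * m_{k+1} <= K * t] with [K] independent of [t]: this is uniform
    strong porosity ([universal_uniform]), which in turn trivially implies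
    complete strong porosity ([uniform_csp]). *)

Set Implicit Arguments.
Unset Strict Implicit.
Unset Printing Implicit Defensive.

(** * Real sequences and upper limits *)

Lemma halving_cvg0 (R : realType) (u : nat -> R) :
  (forall n, 0 < u n) -> (forall n, u n.+1 <= u n / 2) -> u @ \oo --> (0 : R).
Proof.
move=> u0 uS.
have u_geo n : u n <= geometric (u 0%N) 2^-1 n.
  elim: n => [|n IH]; first by rewrite /geometric /= expr0 mulr1.
  apply: le_trans (uS n) _; move: IH; rewrite /geometric /= exprSr mulrA => IH.
  by rewrite ler_pM2r // invr_gt0.
apply: (squeeze_cvgr _ (cvg_cst 0) (cvg_geometric (u 0%N) _)).
- by apply: nearW => n; rewrite (ltW (u0 n)); exact: u_geo.
- by rewrite ger0_norm; lra.
Qed.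

(** If no index crossed [x], then [x <= l N] would propagate to all later
    indices, against convergence to 0. *)
Lemma crossing_index (R : realType) (l : nat -> R) (N : nat) (x : R) :
  l @ \oo --> (0 : R) -> 0 < x -> x <= l N ->
  exists k, [/\ (N <= k)%N, l k.+1 < x & x <= l k].
Proof.
move=> /cvgr0Pnorm_le l0 x0 xN; apply: contrapT => nk.
have above k : x <= l (N + k)%N.
  elim: k => [|k IH]; first by rewrite addn0.
  rewrite addnS leNgt; apply/negP => lx; apply: nk.
  by exists (N + k)%N; rewrite leq_addr.
have /l0[K _ lK] : 0 < x / 2 by lra.
have := lK (N + K)%N (leq_addl _ _); have := above K => /= h1 h2.
have := le_trans (ler_norm _) h2; lra.
Qed.

Lemma limn_esup_le (R : realType) (u : nat -> R) (c : R) :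
  (\forall n \near \oo, u n <= c) ->
  (limn_esup (fun n => (u n)%:E) <= c%:E)%E.
Proof.
move=> uc; apply: (@le_trans _ _
    (ereal_sup [set (u n)%:E | n in [set n | u n <= c]])).
  by apply: ereal_inf_lbound; exists [set n | u n <= c].
by apply: ge_ereal_sup => _ [n un <-]; rewrite lee_fin.
Qed.

Lemma limn_esup_bounded (R : realType) (u : nat -> R) :
  (limn_esup (fun n => (u n)%:E) < +oo)%E ->
  exists c : R, \forall n \near \oo, u n <= c.
Proof.
move=> /ereal_inf_lt[_ [V Voo <-] sup_lty].
have uV n : V n -> ((u n)%:E <= ereal_sup [set (u n)%:E | n in V])%E.
  by move=> Vn; apply: ereal_sup_ubound; exists n.
exists (fine (ereal_sup [set (u n)%:E | n in V])); apply: filterS Voo => n Vn.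
by move: (uV n Vn) sup_lty; case: (ereal_sup _) => [r| |] //=.
Qed.

(** * Gaps of a set *)

Definition gap (R : realType) (E : set R) (p : R * R) : Prop :=
  0 < p.1 /\ is_component (Ext E) `]p.1, p.2[.

Definition wide_gap (R : realType) (E : set R) (e : R) (p : R * R) : Prop :=
  gap E p /\ p.1 <= e * p.2.

Lemma gap_lt (R : realType) (E : set R) (p : R * R) : gap E p -> p.1 < p.2.
Proof. by case=> p0 /(component_ExtP _ _ p0)[]. Qed.

Lemma gap_free (R : realType) (E : set R) (p : R * R) (t : R) :
  gap E p -> E t -> p.1 < t -> p.2 <= t.
Proof.
move=> [p0 /(component_ExtP _ _ p0)[_ pE _]] Et pt.
rewrite leNgt; apply/negP => tp.
suff : (`]p.1, p.2[ `&` E) t by rewrite pE.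
by split => //=; rewrite in_itv /= pt.
Qed.

(** Both gaps lie in [`]p.1, max p.2 q.2[], which misses [E] because the two
    intervals overlap; by maximality each of them is equal to it. *)
Lemma gap_overlap (R : realType) (E : set R) (p q : R * R) :
  gap E p -> gap E q -> p.1 <= q.1 -> q.1 < p.2 -> p = q.
Proof.
move=> gp gq pq qp; have := gap_lt gp; have := gap_lt gq.
move=> q12 p12; pose d := Num.max p.2 q.2.
have dP z : (z < d) = (z < p.2) || (z < q.2) by rewrite /d lt_max.
have dE : ~ (`]p.1, d[ `&` E !=set0).
  case=> z [] /=; rewrite in_itv /= dP => /andP[pz /orP[zp|zq]] Ez.
    by have := gap_free gp Ez pz; lra.
  have p2z := gap_free gp Ez pz.
  have q1z : q.1 < z by lra.
  by have := gap_free gq Ez q1z; lra.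
transitivity (p.1, d).
  apply: contrapT => ne; apply: dE.
  case: gp => p0 /(component_ExtP _ _ p0)[_ _]; apply.
    by move=> z; rewrite /= !in_itv /= dP => /andP[-> ->].
  by move=> h; apply: ne; rewrite h; case: (p).
apply: contrapT => ne; apply: dE.
case: gq => q0 /(component_ExtP _ _ q0)[_ _]; apply.
  move=> z; rewrite /= !in_itv /= dP => /andP[qz ->]; rewrite orbT andbT.
  by lra.
by move=> h; apply: ne; rewrite h; case: (q).
Qed.

Lemma gap_left (R : realType) (E : set R) (p q : R * R) :
  gap E p -> gap E q -> q.1 < p.1 -> q.2 <= p.1.
Proof.
move=> gp gq qp; rewrite leNgt; apply/negP => pq.
have qpE := gap_overlap gq gp (ltW qp) pq.
by move: qp; rewrite qpE ltxx.
Qed.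

(** Endpoints of gaps need not belong to [E]; this lemma and the next supply
    points of [E] as close to them as desired, since otherwise the gap could be
    enlarged. *)
Lemma gap_lend_adherent (R : realType) (E : set R) (p : R * R) (r : R) :
  gap E p -> r < p.1 -> exists t, [/\ E t, r < t & t <= p.1].
Proof.
move=> gp rp; have p12 := gap_lt gp.
have [t []] : (`]r, p.2[ `&` E) !=set0.
  case: (gp) => p0 /(component_ExtP _ _ p0)[_ _]; apply.
    by move=> z /=; rewrite !in_itv /=; lra.
  by case=> rE; move: rp; rewrite rE ltxx.
rewrite /= in_itv /= => /andP[rt tp] Et; exists t; split => //.
rewrite leNgt; apply/negP => pt; have := gap_free gp Et pt; lra.
Qed.

Lemma gap_rend_adherent (R : realType) (E : set R) (p : R * R) (r : R) :
  gap E p -> p.2 < r -> exists t, [/\ E t, p.2 <= t & t < r].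
Proof.
move=> gp pr; have p12 := gap_lt gp.
have [t []] : (`]p.1, r[ `&` E) !=set0.
  case: (gp) => p0 /(component_ExtP _ _ p0)[_ _]; apply.
    by move=> z /=; rewrite !in_itv /=; lra.
  by case=> rE; move: pr; rewrite -rE ltxx.
rewrite /= in_itv /= => /andP[pt tr] Et; exists t; split => //.
exact: gap_free gp Et pt.
Qed.

Lemma wide_gap_le (R : realType) (E : set R) (e e' : R) (p : R * R) :
  e <= e' -> wide_gap E e p -> wide_gap E e' p.
Proof.
move=> ee' [gp pe]; split => //; apply: le_trans pe _.
have := gap_lt gp; case: gp => p0 _ p12.
by rewrite ler_pM2r //; lra.
Qed.

(** The relative length [(b - a) / b = 1 - a / b] tends to 1 exactly when the
    gaps are eventually [e]-wide for each [e > 0]. *)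
Lemma IE_wideP (R : realType) (E : set R) (A : nat -> R * R) :
  IE E A <-> [/\ forall n, gap E (A n), lend A @ \oo --> (0 : R)
    & forall e, 0 < e -> \forall n \near \oo, wide_gap E e (A n)].
Proof.
have ratioE n : gap E (A n) -> 0 < rend A n /\
    `|1 - (rend A n - lend A n) / rend A n| = lend A n / rend A n.
  move=> gA; have := gap_lt gA; case: gA => A0 _ A12.
  have r0 : 0 < rend A n by rewrite /rend; lra.
  split => //; rewrite mulrBl divff ?gt_eqF // opprB addrC subrK ger0_norm //.
  by rewrite divr_ge0 // ltW.
split.
- case=> A0 Ac Al /cvgrPdist_le Ar.
  have gA n : gap E (A n) by split; [exact: A0 | exact: Ac].
  split => // e e0; move: (Ar e e0); apply: filterS => n.
  have [r0 ->] := ratioE n (gA n).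
  by rewrite ler_pdivrMr //; split.
- case=> gA Al Aw; split => // [n|n|]; try by case: (gA n).
  apply/cvgrPdist_le => e e0; move: (Aw e e0); apply: filterS => n [_ h].
  by have [r0 ->] := ratioE n (gA n); rewrite ler_pdivrMr.
Qed.

(** * From sequences to points *)

Lemma E0d_gt0 (R : realType) (E : set R) (t : nat -> R) :
  E `<=` Rplus -> E0d E t -> forall n, 0 < t n.
Proof.
move=> E_sub [_ tE _] n; have [/E_sub + tN0] := tE n.
by rewrite /Rplus /= in_itv /= andbT lt_neqAle eq_sym tN0.
Qed.

(** A property that holds at arbitrarily small points of [E], with a parameter
    [n] that may vary, holds along a single sequence: each term is chosen below
    half of the preceding one, which forces both monotonicity and the limit. *)
Lemma E0d_diagonal (R : realType) (E : set R) (P : nat -> R -> Prop) :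
  (forall n (d : R), 0 < d -> exists t, [/\ E t, 0 < t, t < d & P n t]) ->
  exists2 t, E0d E t & forall n, P n (t n).
Proof.
move=> small.
have /choice[g gP] : forall x : nat * R, exists t,
    0 < x.2 -> [/\ E t, 0 < t, t < x.2 & P x.1 t].
  move=> [n d]; have [d0|d0] := ltP 0 d; last by exists 0.
  by have [t tP] := small n d d0; exists t.
pose t := nat_rect (fun=> R) (g (0%N, 1)) (fun n s => g (n.+1, s / 2)).
have t0 n : 0 < t n.
  elim: n => [|n IH] /=; first by have [] := gP (0%N, 1) ltr01.
  have h : 0 < (n.+1, t n / 2).2 by rewrite /= divr_gt0.
  by have [] := gP _ h.
have tS n : [/\ E (t n.+1), t n.+1 < t n / 2 & P n.+1 (t n.+1)].
  have h : 0 < (n.+1, t n / 2).2 by rewrite /= divr_gt0.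
  by have [] := gP _ h.
have [E0 _ _ P0] := gP (0%N, 1) ltr01.
exists t; last by case=> [//|n]; have [] := tS n.
split.
- by apply: nearW => n; have [_ h _] := tS n; have := t0 n; lra.
- move=> n; split; last by rewrite gt_eqF.
  by case: n => [//|n]; have [] := tS n.
- by apply: halving_cvg0 => // n; have [_ /ltW] := tS n.
Qed.

(** The pointwise form of complete strong porosity.  That [C] does not depend
    on [e] is what allows the threshold [1 / (2 * C)] to separate the gaps that
    matter from the others. *)
Definition gaps_comparable (R : realType) (E : set R) (C : R) : Prop :=
  forall e, 0 < e -> exists2 d, 0 < d & forall t, E t -> 0 < t -> t < d ->
    exists p, [/\ wide_gap E e p, t <= C * p.1 & p.1 <= C * t].

(** A diagonal argument: when every [C = k + 1] fails, with a width [e k], the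
    [n]-th term of the test sequence is a counterexample for [k = logn 2 n], a
    function of [n] that takes every value infinitely often. *)
Lemma csp_gaps_comparable (R : realType) (E : set R) :
  completely_strongly_porous E -> exists2 C, 1 <= C & gaps_comparable E C.
Proof.
move=> csp; apply: contrapT => nU.
have /choice[e eP] : forall k : nat, exists e : R, 0 < e /\
    forall d, 0 < d -> exists t, [/\ E t, 0 < t, t < d &
      forall p, wide_gap E e p -> t <= k.+1%:R * p.1 ->
        ~ p.1 <= k.+1%:R * t].
  move=> k; apply: contrapT => nb; apply: nU; exists k.+1%:R.
    by rewrite ler1n.
  move=> e e0; apply: contrapT => nd; apply: nb; exists e; split=> // d d0.
  apply: contrapT => nt; apply: nd; exists d => // t Et t0 td.
  apply: contrapT => np; apply: nt; exists t; split => // p wp h1 h2.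
  by apply: np; exists p.
have [t tE tP] := @E0d_diagonal _ E (fun n t => forall p,
    wide_gap E (e (logn 2 n)) p -> t <= (logn 2 n).+1%:R * p.1 ->
    ~ p.1 <= (logn 2 n).+1%:R * t)
  (fun n d d0 => (eP (logn 2 n)).2 d d0).
have [A /IE_wideP[gA _ Aw] [c1 [c2 [c10 c20 [N1 _ AN1]]]]] := csp t tE.
have c1V0 : 0 < c1^-1 by rewrite invr_gt0.
pose k := Num.bound (c1^-1 + c2).
have kP : c1^-1 + c2 < k%:R by apply: archi_boundP; lra.
have kS : k%:R <= k.+1%:R :> R by rewrite ler_nat.
have [N2 _ AN2] := Aw _ (eP k).1.
(* An index beyond both thresholds at which counterexamples for [k] sit. *)
pose n := (2 ^ k * (N1 + N2).*2.+1)%N.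
have n_large : (N1 + N2 <= n)%N.
  apply: (@leq_trans (N1 + N2).*2.+1); first by rewrite -addnn -addnS leq_addr.
  by rewrite /n leq_pmull // expn_gt0.
have nk : logn 2 n = k.
  rewrite /n lognM ?expn_gt0 // pfactorK // logn_coprime ?addn0 //.
  by rewrite coprime2n /= odd_double.
have nN1 : (N1 <= n)%N by apply: leq_trans n_large; rewrite leq_addr.
have nN2 : (N2 <= n)%N by apply: leq_trans n_large; rewrite leq_addl.
have /andP[lo hi] := AN1 n nN1.
have t0 : 0 < t n.
  have [A0 _] := gA n; move: hi; rewrite /lend => hi.
  by rewrite -(pmulr_rgt0 _ c20); apply: lt_le_trans hi.
have := tP n (A n); rewrite nk; apply.
- exact: AN2.
- rewrite -(ler_pM2l c10); apply: le_trans lo _; rewrite mulrA /lend.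
  rewrite -[leLHS]mul1r ler_pM2r; last by case: (gA n).
  by rewrite -ler_pdivrMl // mulr1; lra.
- by apply: le_trans hi _; rewrite ler_pM2r //; lra.
Qed.

(** * Construction of the universal sequence *)

Lemma wide_gap_invP (R : realType) (E : set R) (C : R) (p : R * R) :
  1 <= C -> wide_gap E (2 * C)^-1 p <-> gap E p /\ 2 * (C * p.1) <= p.2.
Proof.
move=> C1; have C2 : 0 < 2 * C by lra.
by rewrite /wide_gap ler_pdivlMl // mulrA.
Qed.

(** Take [t] in [E] with [p.1 / 2 < t <= p.1] and the gap [q] that comparability
    yields at [t], both [e]-wide and [1 / (2 * C)]-wide.  It cannot lie to the
    right of [p], as [q.1 <= C * t <= C * p.1 <= p.2 / 2]; nor to the left, as
    then [q.2 <= p.1] and [C * q.1 <= q.2 / 2 <= p.1 / 2 < t].  So [q = p]. *)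
Lemma wide_gap_improve (R : realType) (E : set R) (C e : R) :
  1 <= C -> gaps_comparable E C -> 0 < e ->
  exists2 d, 0 < d & forall p, wide_gap E (2 * C)^-1 p -> p.1 < d ->
    wide_gap E e p.
Proof.
move=> C1 cmp e0; pose e' := Num.min e (2 * C)^-1.
have C0 : 0 < C by lra.
have e'0 : 0 < e' by rewrite lt_min e0 invr_gt0 mulr_gt0.
have [d d0 dP] := cmp e' e'0; exists d => // p.
move=> /(wide_gap_invP _ _ C1)[gp wp] pd; have [p0 _] := gp.
have [|t [Et pt tp]] := @gap_lend_adherent _ _ _ (p.1 / 2) gp; first by lra.
have [||q [wq tq qt]] := dP t Et; try lra.
have gq := wq.1.
have Ctp : C * t <= C * p.1 by rewrite ler_pM2l.
have Cp0 : 0 < C * p.1 by rewrite mulr_gt0.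
have [pq|qp] := leP p.1 q.1.
  rewrite (gap_overlap gp gq pq); last by lra.
  by apply: wide_gap_le wq; rewrite ge_min lexx.
have q2 := gap_left gp gq qp.
have /(wide_gap_invP _ _ C1)[_ Cq] : wide_gap E (2 * C)^-1 q.
  by apply: wide_gap_le wq; rewrite ge_min lexx orbT.
lra.
Qed.

Lemma small_points (R : realType) (E : set R) (d : R) :
  E `<=` Rplus -> limit_point E (0 : R) -> 0 < d ->
  exists t, [/\ E t, 0 < t & t < d].
Proof.
move=> E_sub E0 d0.
have [|t [tN0 Et]] := E0 (ball (0 : R) d); first exact: nbhsx_ballx.
rewrite /ball /= sub0r normrN => td; exists t.
have t0 : 0 <= t by have := E_sub t Et; rewrite /Rplus /= in_itv /= andbT.
split => //; first by rewrite lt_neqAle eq_sym tN0.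
by rewrite -(ger0_norm t0).
Qed.

(** The supremum of the eligible left endpoints is attained: an endpoint [q.1]
    above half the supremum is the greatest, because the left endpoint of a
    wide gap further to the right would be at least [q.2 >= 2 * q.1]. *)
Lemma wide_gap_next (R : realType) (E : set R) (C : R) (p : R * R) :
  E `<=` Rplus -> limit_point E (0 : R) -> 1 <= C -> gaps_comparable E C ->
  0 < p.1 ->
  exists q, [/\ wide_gap E (2 * C)^-1 q, q.1 < p.1 &
    forall r, wide_gap E (2 * C)^-1 r -> r.1 < p.1 -> r.1 <= q.1].
Proof.
move=> E_sub E0 C1 cmp p0; have C0 : 0 < C by lra.
pose S := [set x | exists q, [/\ wide_gap E (2 * C)^-1 q, q.1 = x & x < p.1]].
have S_ub : has_ubound S by exists p.1 => y [q [_ _ /ltW]].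
have [x Sx] : S !=set0.
  have [|d d0 dP] := cmp (2 * C)^-1; first by rewrite invr_gt0 mulr_gt0.
  have [|t [Et t0]] := @small_points _ E (Num.min d (p.1 / C)) E_sub E0.
    by rewrite lt_min d0 divr_gt0.
  rewrite lt_min => /andP[td]; rewrite ltr_pdivlMr // mulrC => tp.
  have [q [wq _ qt]] := dP t Et t0 td.
  by exists q.1, q; split => //; lra.
have s_sup : has_sup S by split => //; exists x.
have s0 : 0 < sup S.
  apply: lt_le_trans (ub_le_sup S_ub Sx).
  by case: Sx => q [[[q0 _] _] <-].
have [|_ [q [wq <- qp]] sq] := @sup_adherent _ S (sup S / 2) _ s_sup.
  by rewrite divr_gt0.
exists q; split => // r wr rp; rewrite leNgt; apply/negP => qr.
have /(ub_le_sup S_ub) rs : S r.1 by exists r.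
have q2 := gap_left wr.1 wq.1 qr.
have [[q0 _] Cq] := (wide_gap_invP _ _ C1).1 wq.
have : q.1 <= C * q.1 by rewrite ler_peMl // ltW.
lra.
Qed.

(** Iterates the previous lemma; the last clause, that no wide gap is skipped,
    is what makes the enumeration universal. *)
Lemma wide_gap_enum (R : realType) (E : set R) (C : R) :
  E `<=` Rplus -> limit_point E (0 : R) -> 1 <= C -> gaps_comparable E C ->
  exists L : nat -> R * R, [/\ forall n, wide_gap E (2 * C)^-1 (L n),
    forall n, lend L n.+1 <= lend L n / 2 &
    forall n r, wide_gap E (2 * C)^-1 r -> r.1 < lend L n ->
      r.1 <= lend L n.+1].
Proof.
move=> E_sub E0 C1 cmp.
have [p0 [w0 _ _]] := @wide_gap_next _ E C (1, 1) E_sub E0 C1 cmp ltr01.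
have /choice[next nextP] : forall p : R * R, exists q : R * R, 0 < p.1 ->
    [/\ wide_gap E (2 * C)^-1 q, q.1 < p.1 &
    forall r, wide_gap E (2 * C)^-1 r -> r.1 < p.1 -> r.1 <= q.1].
  move=> p; have [h|h] := ltP 0 p.1; last by exists p.
  by have [q qP] := @wide_gap_next _ E C p E_sub E0 C1 cmp h; exists q.
pose L n := iter n next p0.
have wL n : wide_gap E (2 * C)^-1 (L n).
  elim: n => [//|n IH] /=.
  by have [] := nextP _ IH.1.1.
exists L; split => // n; last by have [] := nextP _ (wL n).1.1.
have [w lt _] := nextP _ (wL n).1.1.
have le2 := gap_left (wL n).1 w.1 lt.
have [[q0 _] Cq] := (wide_gap_invP _ _ C1).1 w.
have : (next (L n)).1 <= C * (next (L n)).1 by rewrite ler_peMl // ltW.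
by rewrite /lend /=; lra.
Qed.

Lemma universal_of_comparable (R : realType) (E : set R) (C : R) :
  E `<=` Rplus -> limit_point E (0 : R) -> 1 <= C -> gaps_comparable E C ->
  exists L : nat -> R * R,
    [/\ universal E L, IEsd E L & (M L < +oo)%E].
Proof.
move=> E_sub E0 C1 cmp.
have C0 : 0 < C by lra.
have C2V : 0 < (2 * C)^-1 by rewrite invr_gt0 mulr_gt0.
have [L [wL halfL nextL]] := @wide_gap_enum _ E C E_sub E0 C1 cmp.
have L0 n : 0 < lend L n := (wL n).1.1.
have L_cvg : lend L @ \oo --> (0 : R) by exact: halving_cvg0.
have IEL : IE E L.
  apply/IE_wideP; split => // [n|e e0]; first exact: (wL n).1.
  have [d d0 dP] := wide_gap_improve C1 cmp e0.
  have /cvgrPdist_lt/(_ d d0) := L_cvg; apply: filterS => n.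
  by rewrite sub0r normrN gtr0_norm // => /dP; apply.
have Lsd : almost_strictly_decreasing (lend L).
  by apply: nearW => n; have := halfL n; have := L0 n; lra.
have Ld : almost_decreasing (lend L).
  by apply: nearW => n; have := halfL n; have := L0 n; lra.
exists L; split => //.
- split => // A [/IE_wideP[gA Al Aw] _].
  have [N1 _ AN1] := Aw _ C2V.
  have /cvgrPdist_lt/(_ _ (L0 0%N))[N2 _ AN2] := Al.
  exists (maxn N1 N2).
  suff /choice[f fP] : forall n, exists k,
    (maxn N1 N2 <= n)%N -> lend A n = lend L k by exists f.
  move=> n; have [|_] := leqP (maxn N1 N2) n; last by exists 0%N.
  rewrite geq_max => /andP[nN1 nN2].
  have A0 : 0 < lend A n by case: (gA n).
  have := AN2 n nN2; rewrite /= sub0r normrN gtr0_norm // => /ltW AL.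
  have [k [_ kA Ak]] := crossing_index L_cvg A0 AL.
  exists k => _; apply: le_anti; rewrite Ak leNgt; apply/negP => Ak'.
  by have := nextL k (A n) (AN1 n nN1) Ak'; rewrite leNgt kA.
- apply: (@le_lt_trans _ _ (2 * C)%:E); last by rewrite ltry.
  apply: limn_esup_le; have [d d0 dP] := cmp _ C2V.
  have d20 : 0 < d / 2 by lra.
  have /cvgrPdist_lt/(_ _ d20) := L_cvg; apply: filterS => n.
  rewrite sub0r normrN gtr0_norm // => Lnd.
  have gS := (wL n.+1).1; have S12 := gap_lt gS.
  have [S0 CS] := (wide_gap_invP _ _ C1).1 (wL n.+1).
  have m0 : 0 < rend L n.+1 by rewrite /rend; have := S0.1; lra.
  have mL : rend L n.+1 <= lend L n.
    apply: gap_left (wL n).1 gS _.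
    by have := halfL n; have := L0 n; rewrite /lend; lra.
  rewrite ler_pdivrMr //.
  (* At [t] just right of the gap [L n.+1], comparability finds a wide gap [p].
     It cannot be [L n.+1] or a gap nearer to 0, as
     [C * lend L n.+1 <= rend L n.+1 / 2 < t <= C * p.1]. *)
  have [|t [Et mt tm]] := @gap_rend_adherent _ _ _ (2 * rend L n.+1) gS.
    by move: m0; rewrite /rend; lra.
  have [||p [wp tp pt]] := dP t Et.
  + by move: m0 mt; rewrite /rend; lra.
  + by lra.
  have Ctm : C * t <= C * (2 * rend L n.+1) by rewrite ler_pM2l // ltW.
  have [Lp|pL] := leP (lend L n) p.1; first by lra.
  have : C * p.1 <= C * lend L n.+1.
    by rewrite ler_pM2l //; exact: nextL.
  by move: m0 mt CS tp; rewrite /lend /rend; lra.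
Qed.

(** * From a universal sequence back to porosity *)

(** Assign to [t n] the gap [L k] with [lend L k.+1 < t n <= lend L k].  Since
    [t n] belongs to [E] it lies to the right of the whole gap [L k.+1], so
    [lend L k <= K * rend L k.+1 <= K * t n], where [K] depends on [L] only. *)
Lemma universal_uniform (R : realType) (E : set R) (L : nat -> R * R) :
  E `<=` Rplus -> IEd E L -> (M L < +oo)%E -> uniformly_strongly_porous E.
Proof.
move=> E_sub [/IE_wideP[gL Ll Lw] [N1 _ LN1]] /limn_esup_bounded[K [N2 _ LK]].
have L0 n : 0 < lend L n by case: (gL n).
pose N := maxn N1 N2.
have Lmono i j : (N <= i)%N -> (i <= j)%N -> lend L j <= lend L i.
  move=> Ni; elim: j => [|j IH]; first by rewrite leqn0 => /eqP ->.
  rewrite leq_eqVlt => /orP[/eqP -> //|]; rewrite ltnS => ij.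
  apply: le_trans (IH ij); apply: LN1 => /=.
  by apply: leq_trans ij; apply: leq_trans Ni; exact: leq_maxl.
(* [K] itself might not be positive. *)
exists (Num.max K 1); first by rewrite lt_max ltr01 orbT.
move=> t tE0; have [_ tE tl] := tE0.
have t0 := E0d_gt0 E_sub tE0.
have /choice[k kP] : forall n, exists k, t n <= lend L N ->
    [/\ (N <= k)%N, lend L k.+1 < t n & t n <= lend L k].
  move=> n; have [h|h] := leP (t n) (lend L N); last by exists N.
  by have [k kP] := crossing_index Ll (t0 n) h; exists k.
have t_small d : 0 < d -> \forall n \near \oo, t n < d.
  move=> d0; have /cvgrPdist_lt/(_ d d0) := tl; apply: filterS => n.
  by rewrite sub0r normrN gtr0_norm.
have k_large j : \forall n \near \oo, (j <= k n)%N.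
  apply: filterS (t_small _ (L0 (maxn N j))) => n tn.
  have [|Nk kt _] := kP n.
    by apply: le_trans (ltW tn) _; apply: Lmono => //; exact: leq_maxl.
  rewrite leqNgt; apply/negP => kj.
  suff : lend L (maxn N j) <= lend L (k n).+1 by lra.
  apply: Lmono; first exact: leqW.
  by rewrite leq_max kj orbT.
exists (L \o k); split.
- apply/IE_wideP; split => [n|/=|e e0]; first exact: gL.
    apply/cvgrPdist_lt => e e0; have /cvgrPdist_lt/(_ e e0)[j _ jP] := Ll.
    by apply: filterS (k_large j) => n; exact: jP.
  have [j _ jP] := Lw e e0.
  by apply: filterS (k_large j) => n; exact: jP.
- by apply: filterS (t_small _ (L0 N)) => n /ltW /kP[].
- apply: limn_esup_le; apply: filterS (t_small _ (L0 N)) => n /ltW /kP[Nk kt _].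
  rewrite ler_pdivrMr //.
  have [Et _] := tE n.
  have mt := gap_free (gL (k n).+1) Et kt.
  have m0 : 0 < rend L (k n).+1.
    by have := gap_lt (gL (k n).+1); have := L0 (k n).+1;
      rewrite /lend /rend; lra.
  have := LK (k n) (leq_trans (leq_maxr _ _) Nk).
  rewrite /= ler_pdivrMr // => h; apply: le_trans h _.
  apply: (@le_trans _ _ (Num.max K 1 * rend L (k n).+1)).
    by rewrite ler_pM2r // le_max lexx.
  by rewrite ler_pM2l // lt_max ltr01 orbT.
Qed.

Lemma uniform_csp (R : realType) (E : set R) :
  E `<=` Rplus -> uniformly_strongly_porous E -> completely_strongly_porous E.
Proof.
move=> E_sub [c _ cP] t tE; have [A [IEA tA At]] := cP t tE.
have t0 := E0d_gt0 E_sub tE.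
have [K AK] := limn_esup_bounded (le_lt_trans At (ltry c)).
exists A => //; exists 1, (Num.max K 1); split => //.
  by rewrite lt_max ltr01 orbT.
apply: filterS2 tA AK => n tA; rewrite ler_pdivrMr // => AK.
rewrite mul1r tA; apply: le_trans AK _.
by rewrite ler_pM2r // le_max lexx.
Qed.

Unset Implicit Arguments.

Theorem theorem2p18 (R : realType) (E : set R)
  (E_sub : E `<=` Rplus)
  (E_porous : strongly_porous E)
  (E_ac0 : limit_point E (0 : R)) :
  (completely_strongly_porous E <->
     exists L : nat -> R * R,
       [/\ universal E L, IEsd E L & (M L < +oo)%E])
  /\
  ((exists L : nat -> R * R,
       [/\ universal E L, IEsd E L & (M L < +oo)%E])
     <-> uniformly_strongly_porous E).
Proof.
have i_ii : completely_strongly_porous E -> exists L : nat -> R * R,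
    [/\ universal E L, IEsd E L & (M L < +oo)%E].
  move=> /csp_gaps_comparable[C C1 cmp].
  exact: universal_of_comparable E_sub E_ac0 C1 cmp.
have ii_iii : (exists L : nat -> R * R,
    [/\ universal E L, IEsd E L & (M L < +oo)%E]) ->
    uniformly_strongly_porous E.
  by move=> [L [[IEL _] _ ML]]; exact: universal_uniform E_sub IEL ML.
have iii_i := uniform_csp E_sub.
by split; split => //; [move=> /ii_iii | move=> /iii_i].
Qed.
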